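(* Let $\mathbb{M}$ be a compact two-point homogeneous manifold and let $K:\mathbb{M}\times\mathbb{M}\to\mathbb{C}$ be a continuous positive definite kernel of the form $$K(\xi,\zeta)=\sum_{k=0}^{\infty}\sum_{j=1}^{m_k}d_{j,k}\,f_{j,k}(\xi)\overline{f_{j,k}(\zeta)},\qquad d_{j,k}\in\mathbb{C}.$$ Put $\mathcal{F}:=\{(j,k): d_{j,k}>0\}$, $A_k:=\{j:(j,k)\in\mathcal{F}\}$ and $N:=\{k\in\mathbb{Z}_+ : d_{j,k}\neq 0 \text{ for some } j\}$. Then the following properties are equivalent: 1. $K$ is strictly positive definite on $\mathbb{M}$. 2. For any finite set $\Xi\subset\mathbb{M}$ of distinct points and any coefficients $c_\xi\in\mathbb{C}$ ($\xi\in\Xi$): if $\sum_{\xi\in\Xi}c_\xi f_{j,k}(\xi)=0$ for all $(j,k)\in\mathcal{F}$, then $c_\xi=0$ for all $\xi\in\Xi$. 3. For any finite set $\Xi\subset\mathbb{M}$ of distinct points and any coefficients $c_\xi\in\mathbb{C}$ ($\xi\in\Xi$): if $\sum_{\xi\in\Xi}c_\xi\sum_{j\in A_k}f_{j,k}(\xi)\overline{f_{j,k}(\zeta)}=0$ for all $k\in N$ and all $\zeta\in\mathbb{M}$, then $c_\xi=0$ for all $\xi\in\Xi$.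
   Context: A compact two-point homogeneous manifold $\mathbb{M}$ is (up to isomorphism) one of: the sphere $\mathbb{S}^{d-1}$, the real projective space $P^{d-1}(\mathbb{R})$, the complex projective space $P^{d-1}(\mathbb{C})$, the quaternionic projective space $P^{d-1}(H)$, or the Cayley projective plane $P^{16}(Cay)$ (superscripts denote real dimension). $\mathbb{Z}_+=\{0,1,2,\ldots\}$. Fix an orthonormal basis $\{f_{j,k}: k\in\mathbb{Z}_+,\ 1\le j\le m_k\}$ of $L^2(\mathbb{M})$ (with respect to the invariant measure) consisting of smooth functions which are eigenfunctions of the Laplace-Beltrami operator, where for each $k$ the functions $f_{1,k},\ldots,f_{m_k,k}$ form a basis of the ($m_k$-dimensional) eigenspace $H_k$ belonging to the $k$-th distinct eigenvalue (the distinct eigenvalues being listed in increasing order, starting with $0$ for $k=0$). A Hermitian kernel $K:\mathbb{M}\times\mathbb{M}\to\mathbb{C}$ is positive definite on $\mathbb{M}$ if for every finite set $\Xi\subset\mathbb{M}$ of distinct points the matrix $(K(\xi,\zeta))_{\xi,\zeta\in\Xi}$ is positive semi-definite on $\mathbb{C}^{|\Xi|}$; it is strictly positive definite if this matrix is positive definite for every such $\Xi$. A kernel of the series form in the claim is positive definite if and only if all $d_{j,k}\ge 0$. The series is understood to converge (pointwise) to $K$. *)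

(* Defs.v *)
From HB Require Import structures.
From mathcomp Require Import all_boot all_order all_algebra.
From mathcomp Require Import all_classical all_reals all_analysis.
From mathcomp Require Import complex.
Set Implicit Arguments.
Unset Strict Implicit.
Unset Printing Implicit Defensive.
Import Order.TTheory GRing.Theory Num.Theory.
Import numFieldNormedType.Exports.
Local Open Scope classical_set_scope.
Local Open Scope ring_scope.

(* Levels 0, 1, 2, 3 of the Cayley-Dickson construction are R, C, H, O. *)

Fixpoint cd_dim (l : nat) : nat :=
  if l is l'.+1 then (cd_dim l' + cd_dim l')%N else 1%N.

Section CayleyDickson.
Variable R : realType.

Fixpoint cd_one (l : nat) : 'rV[R]_(cd_dim l) :=
  match l with
  | 0 => const_mx 1
  | l'.+1 => row_mx (cd_one l') 0
  end.

Fixpoint cd_conj (l : nat) : 'rV[R]_(cd_dim l) -> 'rV[R]_(cd_dim l) :=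
  match l with
  | 0 => id
  | l'.+1 => fun x => row_mx (cd_conj (lsubmx x)) (- rsubmx x)
  end.

(* (a, b) (c, d) = (a c - d^* b, d a + b c^* ) *)
Fixpoint cd_mul (l : nat) :
    'rV[R]_(cd_dim l) -> 'rV[R]_(cd_dim l) -> 'rV[R]_(cd_dim l) :=
  match l with
  | 0 => fun x y => \row_j (x 0 j * y 0 j)
  | l'.+1 => fun x y =>
      let a := lsubmx x in let b := rsubmx x in
      let c := lsubmx y in let d := rsubmx y in
      row_mx (cd_mul a c - cd_mul (cd_conj d) b)
             (cd_mul d a + cd_mul b (cd_conj c))
  end.

End CayleyDickson.

Section Models.
Variable R : realType.

Definition eucl_dot p q (x y : 'M[R]_(p, q)) : R :=
  \sum_a \sum_b x a b * y a b.

Definition unit_sphere (n : nat) : set 'M[R]_(1, n.+2) :=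
  [set x | eucl_dot x x = 1].

(* An s x s matrix over the algebra A of level l is stored as a real matrix
   whose row [mxvec_index i j] lists the coordinates of the entry (i, j). *)
Definition cd_entry l s (X : 'M[R]_(s * s, cd_dim l)) (i j : 'I_s)
  : 'rV[R]_(cd_dim l) := row (mxvec_index i j) X.


(* The points of the projective space of dimension s - 1 over A, i.e. the
   lines of A^s, are identified with the orthogonal projections onto them: the
   Hermitian idempotents of trace 1.  For the octonions and s = 3 this is the
   usual definition of the Cayley plane.  The Euclidean metric induces the
   invariant Riemannian metric (up to a constant factor). *)
Definition projective_space (l s : nat) : set 'M[R]_(s * s, cd_dim l) :=
  [set X | [/\ forall i j, cd_entry X j i = cd_conj (cd_entry X i j),
               forall i j,
                 \sum_k cd_mul (cd_entry X i k) (cd_entry X k j) = cd_entry X i j &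
               \sum_i cd_entry X i i = cd_one R l]].

End Models.

(* [Sphere n], [RealProj n], [ComplexProj n] and [QuatProj n] are S^(n+1) and
   the projective spaces of dimension n + 1 over R, C and H. *)
Inductive two_point_homogeneous : Set :=
  | Sphere of nat
  | RealProj of nat
  | ComplexProj of nat
  | QuatProj of nat
  | CayleyPlane.

Definition tph_rows (M : two_point_homogeneous) : nat :=
  match M with
  | Sphere _ => 1
  | RealProj n | ComplexProj n | QuatProj n => n.+2 * n.+2
  | CayleyPlane => 3 * 3
  end.

Definition tph_cols (M : two_point_homogeneous) : nat :=
  match M with
  | Sphere n => n.+2
  | RealProj _ => cd_dim 0
  | ComplexProj _ => cd_dim 1
  | QuatProj _ => cd_dim 2
  | CayleyPlane => cd_dim 3
  end.

(* Real dimension: the projective space of s x s matrices over an algebra of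
   dimension a has dimension a (s - 1). *)
Definition tph_dim (M : two_point_homogeneous) : nat :=
  match M with
  | Sphere n => n.+1
  | RealProj n => n.+1
  | ComplexProj n => 2 * n.+1
  | QuatProj n => 4 * n.+1
  | CayleyPlane => 16
  end.

Definition tph_carrier (R : realType) (M : two_point_homogeneous) :
    set 'M[R]_(tph_rows M, tph_cols M) :=
  match M with
  | Sphere n => @unit_sphere R n
  | RealProj n => @projective_space R 0 n.+2
  | ComplexProj n => @projective_space R 1 n.+2
  | QuatProj n => @projective_space R 2 n.+2
  | CayleyPlane => @projective_space R 3 3
  end.

Section Points.
Variable R : realType.

Lemma unit_sphere_nonempty n : exists x, @unit_sphere R n x.
Proof.
exists (delta_mx 0 0); rewrite /unit_sphere /eucl_dot /= big_ord1.
rewrite (bigD1 ord0) //= big1 => [|i i0]; rewrite !mxE ?eqxx ?mulr1 ?addr0 //.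
by rewrite (negPf i0) mulr0.
Qed.

Lemma cd_conj0 l : cd_conj (0 : 'rV[R]_(cd_dim l)) = 0.
Proof. by elim: l => //= l IH; rewrite !linear0 IH row_mx0. Qed.

Lemma cd_mul0l l (x : 'rV[R]_(cd_dim l)) : cd_mul 0 x = 0.
Proof.
suff [] : (forall x : 'rV[R]_(cd_dim l), cd_mul 0 x = 0) /\
          (forall x : 'rV[R]_(cd_dim l), cd_mul x 0 = 0) by [].
elim: l {x} => [|l [IH1 IH2]]; split => x /=.
- by apply/rowP => j; rewrite !mxE mul0r.
- by apply/rowP => j; rewrite !mxE mulr0.
- by rewrite !linear0 !IH1 !IH2 subr0 addr0 row_mx0.
- by rewrite !linear0 !cd_conj0 !IH1 !IH2 subr0 addr0 row_mx0.
Qed.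

Lemma cd_mul0r l (x : 'rV[R]_(cd_dim l)) : cd_mul x 0 = 0.
Proof.
elim: l x => [|l IH] x /=; first by apply/rowP => j; rewrite !mxE mulr0.
by rewrite !linear0 !cd_conj0 !IH !cd_mul0l subr0 addr0 row_mx0.
Qed.

Lemma cd_conj1 l : cd_conj (cd_one R l) = cd_one R l.
Proof. by elim: l => //= l IH; rewrite row_mxKl row_mxKr IH oppr0. Qed.

Lemma cd_mul11 l : cd_mul (cd_one R l) (cd_one R l) = cd_one R l.
Proof.
elim: l => [|l IH] /=; first by apply/rowP => j; rewrite !mxE mulr1.
by rewrite !row_mxKl !row_mxKr IH cd_conj0 cd_conj1 !cd_mul0l subr0 addr0.
Qed.

Lemma projective_space_nonempty l s : exists x, @projective_space R l s.+1 x.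
Proof.
pose X : 'M[R]_(s.+1 * s.+1, cd_dim l) :=
  \matrix_(r, c) if r == mxvec_index ord0 ord0 then cd_one R l 0 c else 0.
have XE i j : cd_entry X i j = if (i == ord0) && (j == ord0) then cd_one R l else 0.
  apply/rowP => c; rewrite !mxE (inj_eq (@cast_ord_inj _ _ _)).
  by rewrite (inj_eq enum_rank_inj) xpair_eqE; case: ifP => _; rewrite ?mxE.
exists X; split=> [i j|i j|].
- by rewrite !XE andbC; case: ifP => _; rewrite ?cd_conj1 ?cd_conj0.
- rewrite (bigD1 ord0) //= big1 => [|k k0]; rewrite !XE ?eqxx /= ?andbT ?addr0.
    by case: eqP => _; case: eqP => _; rewrite /= ?cd_mul11 ?cd_mul0l ?cd_mul0r.
  by rewrite (negPf k0) andbF cd_mul0l.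
- rewrite (bigD1 ord0) //= big1 => [|k k0]; rewrite !XE ?eqxx ?addr0 //.
  by rewrite (negPf k0).
Qed.

Lemma tph_carrier_nonempty M : exists x, @tph_carrier R M x.
Proof.
case: M => [n|n|n|n|] /=.
- exact: unit_sphere_nonempty.
- exact: (@projective_space_nonempty 0 n.+1).
- exact: (@projective_space_nonempty 1 n.+1).
- exact: (@projective_space_nonempty 2 n.+1).
- exact: (@projective_space_nonempty 3 2).
Qed.

End Points.

Definition tph_space (R : realType) (M : two_point_homogeneous) : Type :=
  set_type (@tph_carrier R M).

Section Geometry.
Variables (R : realType) (M : two_point_homogeneous).
Local Notation C := (R[i]%C).
Local Notation space := (tph_space R M).

HB.instance Definition _ := Topological.on space.

Definition tph_point : space :=
  SigSub (mem_set (projT2 (cid (tph_carrier_nonempty R M)))).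

HB.instance Definition _ := isPointed.Build space tph_point.

Definition coords (p : space) : 'M[R]_(tph_rows M, tph_cols M) := \val p.

Fixpoint Ck n (k : nat) (U : set 'rV[R]_n) (F : 'rV[R]_n -> R) : Prop :=
  (forall x, U x -> {for x, continuous F}) /\
  if k is k'.+1 then
    forall i, (forall x, U x -> derivable F x 'e_i) /\
              Ck k' U (fun x => 'D_'e_i F x)
  else True.

Definition Cinfty n (U : set 'rV[R]_n) (F : 'rV[R]_n -> R) : Prop :=
  forall k, Ck k U F.

Definition first_form (phi : 'rV[R]_(tph_dim M) -> space)
    (x : 'rV[R]_(tph_dim M)) : 'M[R]_(tph_dim M) :=
  \matrix_(i, j) \sum_a \sum_b
    ('D_'e_i (fun y => coords (phi y) a b) x *
     'D_'e_j (fun y => coords (phi y) a b) x).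

(* The values of [phi] outside the open set [U] are irrelevant. *)
Definition local_parametrization (U : set 'rV[R]_(tph_dim M))
    (phi : 'rV[R]_(tph_dim M) -> space) : Prop :=
  [/\ open U,
      forall a b, Cinfty U (fun y => coords (phi y) a b),
      forall x, U x -> first_form phi x \in unitmx,
      forall x y, U x -> U y -> phi x = phi y -> x = y &
      forall V, V `<=` U -> open V -> open (phi @` V)].

Definition smooth (u : space -> C) : Prop :=
  forall U phi, local_parametrization U phi ->
    Cinfty U (fun y => complex.Re (u (phi y))) /\
    Cinfty U (fun y => complex.Im (u (phi y))).

(* det(g)^(-1/2) \sum_(i, j) d_i (det(g)^(1/2) g^(ij) d_j v) *)
Definition local_laplacian (phi : 'rV[R]_(tph_dim M) -> space)
    (v : 'rV[R]_(tph_dim M) -> R) (x : 'rV[R]_(tph_dim M)) : R :=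
  let vol y := Num.sqrt (\det (first_form phi y)) in
  (vol x)^-1 * \sum_i
    'D_'e_i (fun y => vol y *
      \sum_j (invmx (first_form phi y) i j * 'D_'e_j v y)) x.

Definition is_laplace_beltrami (u w : space -> C) : Prop :=
  forall U phi, local_parametrization U phi -> forall x, U x ->
    complex.Re (w (phi x)) =
      local_laplacian phi (fun y => complex.Re (u (phi y))) x /\
    complex.Im (w (phi x)) =
      local_laplacian phi (fun y => complex.Im (u (phi y))) x.

(* Eigenspaces of minus the Laplace-Beltrami operator, so that eigenvalues are
   nonnegative. *)
Definition eigenspace_LB (z : C) : set (space -> C) :=
  [set u | smooth u /\ is_laplace_beltrami u (fun p => - (z * u p))].

Definition eigenvalue_LB (z : C) : Prop :=
  exists2 u, eigenspace_LB z u & exists p, u p != 0.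

Definition borel := g_sigma_algebraType (@open space).

Variable mu : {measure set borel -> \bar R}.

(* The isometries of the Euclidean distance between points of the manifold are
   the Riemannian isometries. *)
Definition isometry_tph (g : space -> space) : Prop :=
  forall p q,
    eucl_dot (coords (g p) - coords (g q)) (coords (g p) - coords (g q)) =
    eucl_dot (coords p - coords q) (coords p - coords q).

Definition invariant_measure : Prop :=
  (0 < mu setT < +oo)%E /\
  forall g, isometry_tph g ->
    forall A : set borel, measurable A -> mu (g @^-1` A) = mu A.

Definition inner_L2 (u v : space -> C) : C :=
  Complex
    (Rintegral mu setT (fun p : borel => complex.Re (u p * (v p)^* )))
    (Rintegral mu setT (fun p : borel => complex.Im (u p * (v p)^* ))).

Definition norm2_L2 (u : space -> C) : \bar R :=
  (\int[mu]_(p in setT)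
     (complex.Re (u p) ^+ 2 + complex.Im (u p) ^+ 2)%:E)%E.

Definition in_L2 (u : space -> C) : Prop :=
  [/\ measurable_fun setT (fun p : borel => complex.Re (u p)),
      measurable_fun setT (fun p : borel => complex.Im (u p)) &
      (norm2_L2 u < +oo)%E].

Definition orthonormal_basis_L2 (m : nat -> nat)
    (f : forall k, 'I_(m k) -> space -> C) : Prop :=
  [/\ forall k j, in_L2 (f k j),
      forall k (j : 'I_(m k)) k' (j' : 'I_(m k')),
        inner_L2 (f k j) (f k' j') =
        ((k == k') && (nat_of_ord j == nat_of_ord j'))%:R &
      forall u, in_L2 u -> forall e : R, 0 < e ->
        exists n (c : forall k, 'I_(m k) -> C),
          (norm2_L2 (fun p =>
             u p - \sum_(k < n) \sum_(j < m k) c k j * f k j p)%R < e%:E)%E].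

Definition is_basis_of (m : nat) (H : set (space -> C))
    (b : 'I_m -> space -> C) : Prop :=
  [/\ forall j, H (b j),
      forall c : 'I_m -> C,
        (forall p, \sum_j c j * b j p = 0) -> forall j, c j = 0 &
      forall u, H u -> exists c : 'I_m -> C,
        forall p, u p = \sum_j c j * b j p].

(* [f k j] (j < m k) is a basis of the eigenspace of the k-th distinct
   eigenvalue [lam k]; the index j starts at 0. *)
Record laplace_eigenbasis (lam : nat -> R) (m : nat -> nat)
    (f : forall k, 'I_(m k) -> space -> C) : Prop := LaplaceEigenbasis {
  eigenbasis_lam0 : lam 0%N = 0;
  eigenbasis_lam_incr : forall k l, (k < l)%N -> lam k < lam l;
  eigenbasis_lamP : forall z : C,
    eigenvalue_LB z <-> exists k, z = (lam k)%:C%C;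
  eigenbasis_basis : forall k, is_basis_of (eigenspace_LB (lam k)%:C%C) (@f k);
  eigenbasis_L2 : orthonormal_basis_L2 f
}.

Definition continuous_kernel (K : space -> space -> C) : Prop :=
  continuous (fun p : space * space => K p.1 p.2 : C^o).

End Geometry.

Section Kernels.
Variables (R : realType) (T : Type).
Local Notation C := (R[i]%C).

Definition hermitian_kernel (K : T -> T -> C) : Prop :=
  forall x y, K x y = (K y x)^*.

Definition kernel_matrix (K : T -> T -> C) n (xi : 'I_n -> T) : 'M[C]_n :=
  \matrix_(i, j) K (xi i) (xi j).

Definition quad_form n (A : 'M[C]_n) (c : 'I_n -> C) : C :=
  \sum_i \sum_j (c i)^* * A i j * c j.

(* A finite set of distinct points is given by an injective family. *)
Definition positive_definite_kernel (K : T -> T -> C) : Prop :=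
  hermitian_kernel K /\
  forall n (xi : 'I_n -> T), injective xi ->
    forall c : 'I_n -> C, 0 <= quad_form (kernel_matrix K xi) c.

Definition strictly_positive_definite_kernel (K : T -> T -> C) : Prop :=
  hermitian_kernel K /\
  forall n (xi : 'I_n -> T), injective xi ->
    forall c : 'I_n -> C, (exists i, c i != 0) ->
      0 < quad_form (kernel_matrix K xi) c.

Definition series_kernel (m : nat -> nat) (d : forall k, 'I_(m k) -> C)
    (f : forall k, 'I_(m k) -> T -> C) (K : T -> T -> C) : Prop :=
  forall x y,
    (fun n => \sum_(k < n) \sum_(j < m k) d k j * f k j x * (f k j y)^* : C^o)
      @ \oo --> (K x y : C^o).

End Kernels.

(* Main.v *)
(** Since the Hermitian form of K at the points [xi] with coefficients [c] is
    the sum of the series with nonnegative terms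
    d_{j,k} |\sum_i c_i^* f_{j,k}(xi_i)|^2, it vanishes exactly when all the
    sums \sum_i c_i^* f_{j,k}(xi_i) with d_{j,k} > 0 vanish; this is the
    equivalence of 1 and 2.  That of 2 and 3 is the linear independence of the
    functions f_{1,k}, ..., f_{m_k,k}. *)
Require Import Defs.
From HB Require Import structures.
From mathcomp Require Import all_boot all_order all_algebra.
From mathcomp Require Import all_classical all_reals all_analysis.
From mathcomp Require Import complex.
From mathcomp Require Import ring.
Import Order.TTheory GRing.Theory Num.Theory.
Import numFieldNormedType.Exports.
Local Open Scope classical_set_scope.
Local Open Scope ring_scope.

(** Starting at 0, the sequence is nonnegative; a positive term would bound all later ones from
    below and keep the limit away from 0. *)
Lemma cvg0_nondecreasing_eq0 (C : numFieldType) (u : nat -> C) :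
  u 0%N = 0 -> (forall n, u n <= u n.+1) ->
  ((u : nat -> C^o) @ \oo --> (0 : C^o)) -> forall n, u n = 0.
Proof.
move=> u0 u_nd u_cvg N.
have u_le i j : (i <= j)%N -> u i <= u j.
  elim: j => [|j IH]; first by rewrite leqn0 => /eqP ->.
  rewrite leq_eqVlt => /predU1P[-> //|]; rewrite ltnS => /IH.
  by move/le_trans; apply.
have u_ge0 i : 0 <= u i by rewrite -u0 u_le.
apply/eqP; apply: contraT => uN0.
have uN_gt0 : 0 < u N by rewrite lt_def uN0 u_ge0.
have [n0 _ n0P] := cvgr0_norm_lt _ u_cvg _ uN_gt0.
(* This index lies beyond the threshold [n0], where terms are below [u N], and beyond [N], where
   they are at least [u N]. *)
have := n0P (maxn n0 N) (leq_maxl _ _); rewrite /= ger0_norm //.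
by move/lt_le_trans => /(_ _ (u_le _ _ (leq_maxr n0 N))); rewrite ltxx.
Qed.

Section SeriesKernel.
Variables (R : realType) (T : Type) (m : nat -> nat).
Local Notation C := (R[i]%C).
Variables (d : forall k, 'I_(m k) -> C) (f : forall k, 'I_(m k) -> T -> C).
Variables (K : T -> T -> C) (n : nat) (xi : 'I_n -> T) (c : 'I_n -> C).

(** The quadratic form is a finite linear combination of values of [K], so pointwise convergence of
    the series carries over to it. *)
Lemma quad_form_series_cvg : series_kernel d f K ->
  (fun N => \sum_(k < N) \sum_(j < m k)
     d k j * `|\sum_i (c i)^* * f k j (xi i)| ^+ 2 : C^o) @ \oo -->
  (quad_form (kernel_matrix K xi) c : C^o).
Proof.
move=> Kd.
(* The partial sums become the quadratic forms of the truncated kernels, by expanding the squared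
   modulus as [z * z^*]. *)
rewrite [X in X @ _ --> _](_ : _ = fun N => \sum_i \sum_i' (c i)^* *
   (\sum_(k < N) \sum_(j < m k) d k j * f k j (xi i) * (f k j (xi i'))^*) *
   c i' : C^o); last first.
  apply/funext => N.
  under [RHS]eq_bigr do under eq_bigr do rewrite mulr_sumr mulr_suml.
  under [RHS]eq_bigr do rewrite exchange_big /=.
  rewrite exchange_big; apply: eq_bigr => k _ /=.
  under [RHS]eq_bigr do under eq_bigr do rewrite mulr_sumr mulr_suml.
  under [RHS]eq_bigr do rewrite exchange_big /=.
  rewrite exchange_big; apply: eq_bigr => j _ /=.
  rewrite normCK rmorph_sum mulr_suml mulr_sumr; apply: eq_bigr => i _.
  rewrite !mulr_sumr; apply: eq_bigr => i' _.
  rewrite rmorphM /= conjCK; ring.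
rewrite /quad_form; apply: cvg_big => [|i _]; first exact: add_continuous.
apply: cvg_big => [|i' _]; first exact: add_continuous.
rewrite mxE; apply: cvgM; last exact: cvg_cst.
by apply: cvgM; [exact: cvg_cst | exact: Kd].
Qed.

Lemma quad_form_series_eq0 : series_kernel d f K ->
  (forall k j, 0 <= d k j) ->
  quad_form (kernel_matrix K xi) c = 0 <->
  forall k j, 0 < d k j -> \sum_i (c i)^* * f k j (xi i) = 0.
Proof.
move=> Kd d_ge0; have S_cvg := quad_form_series_cvg Kd.
have t_ge0 k j : 0 <= d k j * `|\sum_i (c i)^* * f k j (xi i)| ^+ 2.
  by rewrite mulr_ge0 ?exprn_ge0.
split=> [Q0 k j d_gt0|S0].
  rewrite Q0 in S_cvg.
  have S_eq0 N : \sum_(k < N) \sum_(j < m k)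
      d k j * `|\sum_i (c i)^* * f k j (xi i)| ^+ 2 = 0.
    apply: (cvg0_nondecreasing_eq0 _ _ _ _ S_cvg); first by rewrite big_ord0.
    by move=> {}N; rewrite big_ord_recr lerDl sumr_ge0.
  (* Removing the vanishing sum over indices below [k] leaves the block of index [k], whose
     nonnegative terms must all be 0. *)
  have := S_eq0 k.+1; rewrite big_ord_recr /= S_eq0 add0r => /eqP.
  rewrite psumr_eq0 // => /allP/(_ j (mem_index_enum _)).
  by rewrite mulf_eq0 (gt_eqF d_gt0) expf_eq0 normr_eq0 => /eqP.
suff S_eq0 : (fun N => \sum_(k < N) \sum_(j < m k)
     d k j * `|\sum_i (c i)^* * f k j (xi i)| ^+ 2) = fun=> 0.
  rewrite S_eq0 in S_cvg.
  by apply: (cvg_unique _ S_cvg (cvg_cst (0 : C^o))); exact: norm_hausdorff.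
apply/funext => N; rewrite big1 // => k _; rewrite big1 // => j _.
have := d_ge0 k j; rewrite le0r => /predU1P[->|/S0->]; first by rewrite mul0r.
by rewrite normr0 expr0n mulr0.
Qed.

End SeriesKernel.

Arguments quad_form_series_eq0 {R T m d f K n xi c}.

Theorem theorem2p1 (R : realType) (M : two_point_homogeneous)
    (mu : {measure set (borel R M) -> \bar R}) (hmu : invariant_measure mu)
    (lam : nat -> R) (m : nat -> nat)
    (f : forall k : nat, 'I_(m k) -> tph_space R M -> R[i]%C)
    (hf : laplace_eigenbasis mu lam f)
    (K : tph_space R M -> tph_space R M -> R[i]%C)
    (d : forall k : nat, 'I_(m k) -> R[i]%C)
    (hKcont : continuous_kernel K)
    (hKpd : positive_definite_kernel K)
    (hKseries : series_kernel d f K)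
    (hKd : positive_definite_kernel K <->
           forall (k : nat) (j : 'I_(m k)), 0 <= d k j) :
  let P1 := strictly_positive_definite_kernel K in
  let P2 :=
    forall (n : nat) (xi : 'I_n -> tph_space R M), injective xi ->
    forall c : 'I_n -> R[i]%C,
      (forall (k : nat) (j : 'I_(m k)), 0 < d k j ->
         \sum_(i < n) c i * f k j (xi i) = 0) ->
      forall i : 'I_n, c i = 0 in
  let P3 :=
    forall (n : nat) (xi : 'I_n -> tph_space R M), injective xi ->
    forall c : 'I_n -> R[i]%C,
      (forall k : nat, (exists j : 'I_(m k), d k j != 0) ->
       forall zeta : tph_space R M,
         \sum_(i < n) c i *
           (\sum_(j < m k | 0 < d k j) f k j (xi i) * (f k j zeta)^*) = 0) ->
      forall i : 'I_n, c i = 0 in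
  (P1 <-> P2) /\ (P2 <-> P3).
Proof.
have /hKd d_ge0 := hKpd.
split; split=> [HP n xi xi_inj c c_sum|HP].
(* [quad_form] conjugates its left coefficients, so conjugating [c] beforehand brings back the sums
   of property 2. *)
- pose c' i := (c i)^*.
  have Q0 : quad_form (kernel_matrix K xi) c' = 0.
    apply/(quad_form_series_eq0 hKseries d_ge0) => k j d_gt0.
    rewrite -[RHS](c_sum k j d_gt0).
    by apply: eq_bigr => i _; rewrite conjCK.
  move=> i; apply/eqP; apply: contraT => ci0.
  have : 0 < quad_form (kernel_matrix K xi) c'.
    by apply: (HP.2 n xi xi_inj); exists i; rewrite conjC_eq0.
  by rewrite Q0 ltxx.
- split=> [|n xi xi_inj c [i ci0]]; first exact: hKpd.1.
  rewrite lt_def hKpd.2 // andbT; apply: contra ci0 => /eqP.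
  move/(quad_form_series_eq0 hKseries d_ge0) => c_sum.
  by rewrite -conjC_eq0 (HP n xi xi_inj (fun i => (c i)^*) c_sum i).
- apply: (HP n xi xi_inj c) => k j d_gt0.
  have [_ f_free _] := eigenbasis_basis hf k.
  (* The sum in property 3, as a function of [zeta], is the conjugate of the combination of the
     [f k j] with coefficients [b j]. Padding by 0 extends it to the whole basis of the eigenspace,
     so that linear independence applies. *)
  pose b j := if 0 < d k j then (\sum_(i < n) c i * f k j (xi i))^* else 0.
  have /f_free/(_ j) : forall p, \sum_j b j * f k j p = 0.
    move=> p; apply/eqP; rewrite -conjC_eq0; apply/eqP.
    rewrite -[RHS](c_sum k _ p); last by exists j; rewrite gt_eqF.
    under [RHS]eq_bigr do rewrite mulr_sumr.
    rewrite exchange_big rmorph_sum big_mkcond [RHS]big_mkcond /=.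
    apply: eq_bigr => j' _; rewrite rmorphM /b; case: ifP => _ /=.
      rewrite conjCK mulr_suml; apply: eq_bigr => i _; exact/esym/mulrA.
    by rewrite rmorph0 mul0r.
  by rewrite /b d_gt0 => /eqP; rewrite conjC_eq0 => /eqP.
- move=> n xi xi_inj c c_sum; apply: (HP n xi xi_inj c) => k _ zeta.
  (* After exchanging the sums, each [(f k j zeta)^*] is multiplied by a sum that vanishes by
     [c_sum]. *)
  under eq_bigr do rewrite mulr_sumr.
  rewrite exchange_big big1 //= => j d_gt0.
  under eq_bigr do rewrite mulrA.
  by rewrite -mulr_suml c_sum // mul0r.
Qed.
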